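(* Let $F$ be an isoparametric polynomial of degree $g\in\{1,2,3,4,6\}$ on $\mathbb{R}^n$. Then the form $H_F(x)=|x|^{2g}-F(x)^2$ is a sum of squares of real forms of degree $g$.
   Context: An isoparametric (Cartan–Münzner) polynomial of degree $g$ on $\mathbb{R}^n$ is a real homogeneous polynomial $F$ of degree $g$ satisfying $$|\nabla F|^2=g^2|x|^{2g-2},\qquad \Delta F=\tfrac{g^2}{2}(m_--m_+)|x|^{g-2}\qquad\text{on }\mathbb{R}^n,$$ where the level hypersurfaces $F^{-1}(t)\cap\mathbb{S}^{n-1}$, $t\in(-1,1)$, are isoparametric hypersurfaces of the unit sphere with $g$ distinct principal curvatures and the positive integers $m_\pm$ are the multiplicities of the maximal and minimal principal curvatures with respect to the normal direction $\nabla f/|\nabla f|$, $f=F|_{\mathbb{S}^{n-1}}$. A form is a homogeneous polynomial. *)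

(* Defs.v *)
From HB Require Import structures.
From mathcomp Require Import all_boot all_order all_algebra.
From mathcomp Require Import mpoly.
From mathcomp Require Import classical_sets reals topology normedtype derive.

Set Implicit Arguments.
Unset Strict Implicit.
Unset Printing Implicit Defensive.

Import Order.TTheory GRing.Theory Num.Theory.
Import numFieldNormedType.Exports.

Local Open Scope classical_set_scope.
Local Open Scope ring_scope.

(* The library norm `|x| on 'rV[R]_n is the sup norm, hence these two. *)
Definition dotv (R : realType) (n : nat) (u v : 'rV[R]_n) : R :=
  \sum_i u 0 i * v 0 i.

Definition enorm (R : realType) (n : nat) (x : 'rV[R]_n) : R :=
  Num.sqrt (dotv x x).

Definition evalv (R : realType) (n : nat) (F : {mpoly R[n]}) (x : 'rV[R]_n) : R :=
  F.@[fun i => x 0 i].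

Definition gradient (R : realType) (n : nat) (F : {mpoly R[n]}) (x : 'rV[R]_n) :
    'rV[R]_n :=
  \row_i evalv F^`M(i) x.

Definition laplacian (R : realType) (n : nat) (F : {mpoly R[n]}) : {mpoly R[n]} :=
  \sum_i (F^`M(i))^`M(i).

(* For x in the unit sphere, this is the gradient at x of the restriction f of F
   to the sphere: the projection of the Euclidean gradient orthogonal to x.  The
   formula extends it to all of R^n, so that it can be differentiated. *)
Definition sphere_gradient (R : realType) (n : nat) (F : {mpoly R[n]})
    (x : 'rV[R]_n) : 'rV[R]_n :=
  gradient F x - dotv (gradient F x) x *: x.

Definition unit_normal (R : realType) (n : nat) (F : {mpoly R[n]})
    (x : 'rV[R]_n) : 'rV[R]_n :=
  (enorm (sphere_gradient F x))^-1 *: sphere_gradient F x.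

Definition level (R : realType) (n : nat) (F : {mpoly R[n]}) (t : R) :
    set 'rV[R]_n :=
  [set x | enorm x = 1 /\ evalv F x = t].

(* Row space: the vectors orthogonal to both x and the gradient of f at x, i.e.
   the tangent space at x of the level hypersurface of f through x. *)
Definition tangent_space (R : realType) (n : nat) (F : {mpoly R[n]})
    (x : 'rV[R]_n) : 'M[R]_n :=
  kermx (col_mx x (sphere_gradient F x))^T.

(* The Weingarten map X |-> - D_X nu, acting on row vectors X; the jacobian 'J is
   transposed, X *m 'J nu x = 'D_X nu x.  It is only meaningful on the tangent
   space, where D_X nu depends only on nu along the hypersurface and is tangent to
   the sphere since <D_X nu, x> = - <nu, X> = 0.  With this sign the Laplacian
   equation below does have the factor m_- - m_+, for m_+ attached to the maximal
   curvature. *)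
Definition shape_operator (R : realType) (n : nat) (F : {mpoly R[n]})
    (x : 'rV[R]_n) : 'M[R]_n :=
  - jacobian (unit_normal F) x.

(* The multiplicity of c as a principal curvature at x; 0 if c is not one. *)
Definition curvature_mult (R : realType) (n : nat) (F : {mpoly R[n]})
    (x : 'rV[R]_n) (c : R) : nat :=
  \rank (eigenspace (shape_operator F x) c :&: tangent_space F x)%MS.

Definition principal_curvature (R : realType) (n : nat) (F : {mpoly R[n]})
    (x : 'rV[R]_n) (c : R) : bool :=
  (0 < curvature_mult F x c)%N.

Definition isoparametric_level (R : realType) (n : nat) (F : {mpoly R[n]})
    (t : R) : Prop :=
  [/\ level F t !=set0,
      forall x, level F t x -> sphere_gradient F x != 0
    & forall x y, level F t x -> level F t y ->
        forall c, curvature_mult F x c = curvature_mult F y c].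

Definition distinct_curvatures (R : realType) (n : nat) (F : {mpoly R[n]})
    (x : 'rV[R]_n) (g : nat) : Prop :=
  exists ks : seq R,
    [/\ uniq ks, size ks = g & forall c, (c \in ks) = principal_curvature F x c].

Definition max_curvature (R : realType) (n : nat) (F : {mpoly R[n]})
    (x : 'rV[R]_n) (c : R) : Prop :=
  principal_curvature F x c /\
  forall d, principal_curvature F x d -> d <= c.

Definition min_curvature (R : realType) (n : nat) (F : {mpoly R[n]})
    (x : 'rV[R]_n) (c : R) : Prop :=
  principal_curvature F x c /\
  forall d, principal_curvature F x d -> c <= d.

(* The exponent g - 2 is an integer, equal to -1 if g = 1; the factor m_- - m_+
   is then 0, so that the convention 0^-1 = 0 at the origin is harmless. *)
Definition isoparametric_polynomial (R : realType) (n g : nat)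
    (F : {mpoly R[n]}) : Prop :=
  F \is g.-homog /\
  exists mp mm : nat,
    [/\ (0 < mp)%N /\ (0 < mm)%N,
        forall x : 'rV[R]_n,
          enorm (gradient F x) ^+ 2 = g%:R ^+ 2 * enorm x ^+ (2 * g - 2),
        forall x : 'rV[R]_n,
          evalv (laplacian F) x =
          g%:R ^+ 2 / 2 * (mm%:R - mp%:R) * enorm x ^ (g%:Z - 2)
      & forall t : R, -1 < t < 1 ->
          isoparametric_level F t /\
          forall x, level F t x ->
            [/\ distinct_curvatures F x g,
                forall c, max_curvature F x c -> curvature_mult F x c = mp
              & forall c, min_curvature F x c -> curvature_mult F x c = mm]].

Definition sqnorm_poly (R : realType) (n : nat) : {mpoly R[n]} :=
  \sum_(i < n) 'X_i ^+ 2.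

Definition H_poly (R : realType) (n g : nat) (F : {mpoly R[n]}) : {mpoly R[n]} :=
  sqnorm_poly R n ^+ g - F ^+ 2.

Definition sos_of_forms (R : realType) (n d : nat) (H : {mpoly R[n]}) : Prop :=
  exists2 s : seq {mpoly R[n]},
    (forall p, p \in s -> p \is d.-homog) & H = \sum_(p <- s) p ^+ 2.

(* Main.v *)
(** By Euler's relation [\sum_i x_i F_i = g F], the eikonal equation
    [|grad F|^2 = g^2 |x|^(2g-2)] and Lagrange's identity,
    [2 g^2 (|x|^(2g) - F^2) = 2 (|x|^2 |grad F|^2 - (x . grad F)^2)
                            = \sum_(i, j) (x_i F_j - x_j F_i)^2],
    and each [x_i F_j - x_j F_i] is a form of degree [g]. *)
Require Import Defs.
From mathcomp Require Import all_boot all_order all_algebra.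
From mathcomp Require Import mpoly.
From mathcomp Require Import reals ring.

Set Implicit Arguments.
Unset Strict Implicit.
Unset Printing Implicit Defensive.

Import Order.TTheory GRing.Theory Num.Theory.

Local Open Scope ring_scope.

(** The naturals below [size p] are pairwise distinct in a [numDomainType], which gives more roots
    than a nonzero [p] can have. *)
Lemma poly_eq0_horner (R : numDomainType) (p : {poly R}) :
  (forall t, p.[t] = 0) -> p = 0.
Proof.
move=> p0; apply: (@roots_geq_poly_eq0 _ _ [seq i%:R | i <- iota 0 (size p)]).
- by apply/allP => t _; rewrite /root p0.
- rewrite map_inj_uniq ?iota_uniq // => i j /eqP.
  by rewrite eqr_nat => /eqP.
- by rewrite size_map size_iota.
Qed.

Lemma mcoeff_muni (R : nzRingType) n (p : {mpoly R[n.+1]}) m :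
  p@_m = (muni p)`_(m ord_max)@_[multinom m (widen_ord (leqnSn n) i) | i < n].
Proof.
rewrite muniE coef_sum raddf_sum {1}[p]mpolyE raddf_sum /=.
apply: eq_bigr => k _; rewrite coefZ coefXn mcoeffZ mcoeffX.
(* A monomial is determined by its last exponent, which [muni] turns into the degree, together with
   the remaining ones. *)
have -> : (k == m) = (k ord_max == m ord_max) &&
  ([multinom k (widen_ord (leqnSn n) i) | i < n] ==
   [multinom m (widen_ord (leqnSn n) i) | i < n]).
  apply/eqP/andP => [->//|[/eqP kmax /eqP /mnmP kw]].
  apply/mnmP => i; have [[j ->]|->//] : (exists j, i = widen_ord (leqnSn n) j) \/ i = ord_max.
    case: (ltnP i n) => [lt_in|le_ni].
      by left; exists (Ordinal lt_in); apply: val_inj.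
    by right; apply/val_inj/eqP; rewrite eqn_leq -ltnS ltn_ord.
  by have := kw j; rewrite !mnmE.
rewrite [m ord_max == _]eq_sym; case: eqVneq => _ /=.
  by rewrite mulr1 mcoeffZ mcoeffX.
by rewrite !mulr0 mcoeff0.
Qed.

Lemma meval_muni (R : comNzRingType) n (p : {mpoly R[n.+1]}) (v : 'I_n.+1 -> R) :
  p.@[v] = (map_poly (meval (fun i => v (widen_ord (leqnSn n) i))) (muni p)).[v ord_max].
Proof.
rewrite muniE rmorph_sum horner_sum /= mevalE; apply: eq_bigr => m _.
rewrite map_polyZ map_polyXn hornerZ hornerXn /= mevalZ mevalX -mulrA.
rewrite big_ord_recr; congr (_ * (_ * _)).
by apply: eq_bigr => i _; rewrite mnmE.
Qed.

(** Induction on the number of variables: once the first [n] values are fixed, [muni p] becomes a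
    univariate polynomial with no nonzero value, so each coefficient of [muni p] vanishes at every
    point. *)
Lemma mpoly_eq0_meval (R : numDomainType) n (p : {mpoly R[n]}) :
  (forall v, p.@[v] = 0) -> p = 0.
Proof.
elim: n p => [|n IHn] p p0.
  have := p0 (fun=> 0); rewrite [p in p.@[_]]nvar0_mpolyC mevalC => pC.
  by rewrite [p]nvar0_mpolyC pC.
suff muni0 k : (muni p)`_k = 0.
  by apply/mpolyP => m; rewrite mcoeff_muni muni0 !mcoeff0.
apply: IHn => v; rewrite -coef_map.
have -> : map_poly (meval v) (muni p) = 0; last by rewrite coef0.
apply: poly_eq0_horner => t.
(* [w] extends the point [v] by the value [t] in the last coordinate. *)
pose w (i : 'I_n.+1) := if insub (val i) is Some j then v j else t.
have := p0 w; rewrite meval_muni {2}/w insubF ?ltnn // => <-.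
congr (_.[_]); apply: eq_map_poly => q; apply: meval_eq => i.
by rewrite /w (valK i).
Qed.

Lemma mderiv_homog (R : nzRingType) n d (p : {mpoly R[n]}) i :
  p \is d.-homog -> p^`M(i) \is d.-1.-homog.
Proof.
move=> /dhomogP hp; apply/dhomogP => m; rewrite mcoeff_msupp mcoeff_deriv => pm.
rewrite -(hp (m + U_(i))%MM) /=; first by rewrite mdegD mdeg1 addn1.
by rewrite mcoeff_msupp; apply: contraNneq pm => ->; rewrite mul0rn.
Qed.

(** On a monomial, ['X_i] times the [i]-th derivative multiplies by the exponent [m i], and these
    exponents add up to [d]. *)
Lemma euler_mpoly (R : comNzRingType) n d (p : {mpoly R[n]}) :
  p \is d.-homog -> \sum_i 'X_i * p^`M(i) = d%:R *: p.
Proof.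
move=> /dhomogP hp; rewrite {2}[p]mpolyE scaler_sumr.
under eq_bigr do rewrite /mderiv mulr_sumr.
rewrite exchange_big; apply: eq_big_seq => m /hp <-.
rewrite /= mdegE natr_sum scaler_suml; apply: eq_bigr => i _.
(* If [m i = 0], the truncated exponent [m - U_(i)] is not the true one, but its coefficient is
   zero. *)
rewrite scalerA -scalerAr -mpolyXD; have [->|mi_gt0] := posnP (m i).
  by rewrite mul0r !scale0r.
by rewrite addmC submK // lep1mP -lt0n.
Qed.

(** The factor 2 arises because the sum runs over ordered pairs: the two families of squares in the
    expansion agree after exchanging indices. *)
Lemma lagrange_identity (R : comNzRingType) n (a b : 'I_n -> R) :
  \sum_(ij : 'I_n * 'I_n) (a ij.1 * b ij.2 - a ij.2 * b ij.1) ^+ 2 =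
  ((\sum_i a i ^+ 2) * (\sum_i b i ^+ 2) - (\sum_i a i * b i) ^+ 2) *+ 2.
Proof.
rewrite -(pair_bigA _ (fun i j => (a i * b j - a j * b i) ^+ 2)) /=.
have sq : \sum_i \sum_j a i ^+ 2 * b j ^+ 2 =
    (\sum_i a i ^+ 2) * \sum_i b i ^+ 2 by rewrite big_distrlr.
transitivity (\sum_i \sum_j (a i ^+ 2 * b j ^+ 2) +
              \sum_i \sum_j (a j ^+ 2 * b i ^+ 2) -
              (\sum_i \sum_j (a i * b i) * (a j * b j)) *+ 2); last first.
  rewrite [X in _ + X - _]exchange_big /= sq -big_distrlr /= -expr2.
  by rewrite -mulr2n mulrnBl.
rewrite -sumrMnl -big_split -sumrB; apply: eq_bigr => i _ /=.
rewrite -sumrMnl -big_split -sumrB; apply: eq_bigr => j _ /=.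
ring.
Qed.

Lemma enorm_sqr (R : realType) n (x : 'rV[R]_n) : enorm x ^+ 2 = dotv x x.
Proof. by rewrite sqr_sqrtr // sumr_ge0 // => i _; rewrite -expr2 sqr_ge0. Qed.

(** The exponent [2 * g - 2] is even, so both sides of the pointwise equation are polynomial in [x],
    and agreement at all points makes them equal as polynomials. *)
Lemma eikonal_mpoly (R : realType) n g (F : {mpoly R[n]}) :
  (forall x, enorm (gradient F x) ^+ 2 = g%:R ^+ 2 * enorm x ^+ (2 * g - 2)) ->
  \sum_i F^`M(i) ^+ 2 = g%:R ^+ 2 *: sqnorm_poly R n ^+ g.-1.
Proof.
move=> eik; apply/eqP; rewrite -subr_eq0; apply/eqP/mpoly_eq0_meval => v.
have degE : (2 * g - 2 = 2 * g.-1)%N by rewrite -subn1 mulnBr muln1.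
have := eik (\row_i v i); rewrite degE exprM !enorm_sqr.
have vE : (fun i => (\row_i v i) 0 i) =1 v by move=> i; rewrite mxE.
have -> : dotv (\row_i v i) (\row_i v i) = (sqnorm_poly R n).@[v].
  rewrite rmorph_sum; apply: eq_bigr => i _.
  by rewrite rmorphXn /= mevalXU !mxE.
rewrite mevalB mevalZ rmorphXn /= => <-; apply/eqP; rewrite subr_eq0; apply/eqP.
rewrite rmorph_sum; apply: eq_bigr => i _.
by rewrite rmorphXn !mxE /evalv (meval_eq _ vE).
Qed.

Theorem proposition2p1 (R : realType) (n g : nat) (F : {mpoly R[n]})
  (hg : g \in [:: 1; 2; 3; 4; 6]%N)
  (hF : isoparametric_polynomial g F) :
  sos_of_forms g (H_poly g F).
Proof.
have g_gt0 : (0 < g)%N by case: g hg {hF}.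
have [homF [_ [_ [_ /eikonal_mpoly eikF _ _]]]] := hF.
(* [c ^+ 2] is the inverse of [2 g^2], with 2 from Lagrange's identity and [g^2] from Euler's
   relation and the eikonal equation; a real root lets it be absorbed into the forms. *)
pose c : R := Num.sqrt (g%:R ^+ 2 *+ 2)^-1.
pose L (ij : 'I_n * 'I_n) := 'X_ij.1 * F^`M(ij.2) - 'X_ij.2 * F^`M(ij.1).
have homXF i j : 'X_i * F^`M(j) \is g.-homog.
  rewrite -(prednK g_gt0) -add1n; apply/dhomogM/mderiv_homog => //.
  by rewrite dhomogX /= mdeg1.
exists [seq c *: L ij | ij <- enum {: 'I_n * 'I_n}].
  by move=> _ /mapP[ij _ ->]; apply/rpredZ/rpredB; apply: homXF.
rewrite big_map big_enum /=; under eq_bigr do rewrite exprZn.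
rewrite -scaler_sumr (lagrange_identity (fun i => 'X_i) (fun i => F^`M(i))).
rewrite -/(sqnorm_poly R n) eikF (euler_mpoly homF) exprZn.
(* Since [g] is positive, [|x|^2] times [|x|^(2(g-1))] is [|x|^(2g)]; then [g^2] factors out and
   [c ^+ 2] cancels the constant. *)
rewrite -scalerAr -exprS prednK // -scalerBr scalerMnl scalerA.
rewrite sqr_sqrtr ?invr_ge0 ?mulrn_wge0 ?sqr_ge0 // mulVf ?scale1r //.
by rewrite mulrn_eq0 expf_eq0 /= pnatr_eq0 -lt0n.
Qed.
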